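(* Let $\beta \in (0,d]$ and let $Q_0\subset\mathbb{R}^d$ be a cube. There exist constants $c,C>0$ such that $$\mathcal{H}^{\beta}_\infty\left(\{x\in Q:|u(x)-c_Q|>t\}\right) \leq C\, l(Q)^\beta \exp\left(-ct/\|u\|_{BMO^\beta(Q_0)}\right)$$ for every $t>0$, every $u \in BMO^\beta(Q_0)$, every finite subcube $Q\subset Q_0$ with sides parallel to those of $Q_0$, and suitable constants $c_Q \in \mathbb{R}$ (depending on $u$ and $Q$).
   Context: $\mathcal{H}^{\beta}_{\infty}(E)= \inf \{\sum_{i} \omega_\beta r_i^\beta : E \subset \bigcup_{i} B(x_i,r_i) \}$ (countable ball covers), $\omega_\beta= \pi^{\beta/2}/\Gamma(\beta/2+1)$. $f$ is $\mathcal{H}^\beta_\infty$-quasicontinuous if for every $\epsilon>0$ there is an open $O$ with $\mathcal{H}^\beta_\infty(O)<\epsilon$ and $f|_{O^c}$ continuous. Choquet integral: $\int_A f\,d\mathcal{H}^\beta_\infty=\int_0^\infty \mathcal{H}^\beta_\infty(\{x\in A: f(x)>t\})\,dt$ for $f\ge0$. $L^1(Q_0;\mathcal{H}^\beta_\infty)$: quasicontinuous $f$ with $\int_{Q_0}|f|\,d\mathcal{H}^\beta_\infty<\infty$. $\|u\|_{BMO^{\beta}(Q_0)}= \sup_{Q} \inf_{c \in \mathbb{R}} l(Q)^{-\beta} \int_{Q} |u-c| \,d\mathcal{H}^{\beta}_\infty$ over finite subcubes $Q\subset Q_0$ with sides parallel to those of $Q_0$, $l(Q)$ = side length; $BMO^\beta(Q_0)$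 is the set of $u\in L^1(Q_0;\mathcal{H}^\beta_\infty)$ with this finite. *)

(* Defs.v *)
From HB Require Import structures.
From mathcomp Require Import all_boot all_order all_algebra.
From mathcomp Require Import all_classical all_reals all_analysis.
Set Implicit Arguments. Unset Strict Implicit. Unset Printing Implicit Defensive.
Import Order.TTheory GRing.Theory Num.Theory.
Import numFieldNormedType.Exports.
Local Open Scope classical_set_scope.
Local Open Scope ring_scope.

Section Defs.
Variables (R : realType) (d : nat).
Local Notation V := 'rV[R]_d.

Definition enorm (x : V) : R := Num.sqrt (\sum_(i < d) x ord0 i ^+ 2).
Definition eball (x : V) (r : R) : set V := [set y | enorm (y - x) < r].

Definition Gamma (s : R) : R :=
  fine (\int[@lebesgue_measure R]_(x in `]0%R, +oo[) (powR x (s - 1) * expR (- x))%:E)%E.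

Definition omega (beta : R) : R := powR pi (beta / 2) / Gamma (beta / 2 + 1).

Definition hcontent (beta : R) (E : set V) : \bar R :=
  ereal_inf [set (\sum_(0 <= i <oo) (omega beta * powR (r i) beta)%:E)%E
            | r in [set r : nat -> R | exists x : nat -> V,
                       (forall i, 0 < r i) /\ E `<=` \bigcup_i eball (x i) (r i)]].

Definition choquet (beta : R) (A : set V) (f : V -> R) : \bar R :=
  (\int[@lebesgue_measure R]_(t in `[0%R, +oo[)
      hcontent beta [set x | A x /\ (t < f x)%R])%E.

Definition quasicontinuous (beta : R) (Q0 : set V) (f : V -> R) : Prop :=
  forall eps : R, 0 < eps -> exists O : set V,
    open O /\ (hcontent beta O < eps%:E)%E /\ {within Q0 `\` O, continuous f}.

Definition L1H (beta : R) (Q0 : set V) (f : V -> R) : Prop :=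
  quasicontinuous beta Q0 f /\ (choquet beta Q0 (fun x => `|f x|%R) < +oo)%E.

Definition orthogonal_mx (U : 'M[R]_d) : Prop := U *m U^T = 1%:M.

(* The closed cube with corner a, side length l > 0 and edge directions given
   by the rows of the orthogonal matrix U:  { a + l * y U : y in [0,1]^d } *)
Definition cube (U : 'M[R]_d) (a : V) (l : R) : set V :=
  [set a + (l *: y) *m U | y in [set y : V | forall i, 0 <= y ord0 i <= 1]].

Definition is_cube (Q0 : set V) (U : 'M[R]_d) (l0 : R) : Prop :=
  orthogonal_mx U /\ 0 < l0 /\ exists a, Q0 = cube U a l0.

Definition subcube (Q0 : set V) (U : 'M[R]_d) (Q : set V) (l : R) : Prop :=
  0 < l /\ (exists a, Q = cube U a l) /\ Q `<=` Q0.

Definition bmo_norm (beta : R) (Q0 : set V) (U : 'M[R]_d) (u : V -> R) : \bar R :=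
  ereal_sup [set (ereal_inf [set ((powR Ql.2 (- beta))%:E
                                   * choquet beta Ql.1 (fun x => `|u x - c|%R))%E
                            | c in [set: R]])
            | Ql in [set Ql : set V * R | subcube Q0 U Ql.1 Ql.2]].

Definition BMO (beta : R) (Q0 : set V) (U : 'M[R]_d) (u : V -> R) : Prop :=
  L1H beta Q0 u /\ (bmo_norm beta Q0 U u < +oo)%E.

End Defs.

(* Main.v *)
(* John-Nirenberg iteration with the content H in place of a measure.  If E is
   the set of points of Q where |u - c_Q| > lambda, Chebyshev's inequality for
   the Choquet integral gives H(E) <= (M / lambda) l(Q)^beta.  Cover E by dyadic
   subcubes R_i of Q with small total weight sum_i l(R_i)^beta, and let the
   stopping cubes S_j be the maximal dyadic cubes S with
     sum_(R_i in S) l(R_i)^beta >= theta l(S)^beta.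
   These sums are additive, unlike H, so sum_j l(S_j)^beta <= l(Q)^beta / 2, and
   the S_j cover every point of E.  The parent P of S_j is not a stopping cube,
   so E has small content in P; since beta <= d the content of a cube is
   comparable to l^beta, hence some point of P lies outside E and
   |c_(S_j) - c_Q| <= 4 lambda.  Therefore the level t + 5 lambda on Q is
   controlled by the level t on the S_j, at half the total weight, and iterating
   gives the exponential decay. *)
Require Import Defs.
From HB Require Import structures.
From mathcomp Require Import all_boot all_order all_algebra.
From mathcomp Require Import all_classical all_reals all_analysis.
From mathcomp Require Import ring lra zify.
Set Implicit Arguments. Unset Strict Implicit. Unset Printing Implicit Defensive.
Import Order.TTheory GRing.Theory Num.Theory.
Import numFieldNormedType.Exports.
Local Open Scope classical_set_scope.
Local Open Scope ring_scope.

(** * Monotonicity of nonnegative integrals and series *)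

(** The integral of a nonnegative function is a supremum over simple functions below it, so a larger
    integrand only enlarges the family. This also covers integrands not known to be measurable, such
    as the level contents in [choquet]. *)
Lemma le_integral_nonneg (dd : measure_display) (T : measurableType dd)
    (R : realType) (mu : {measure set T -> \bar R}) (D : set T)
    (f g : T -> \bar R) :
  (forall x, D x -> 0 <= f x)%E -> (forall x, D x -> f x <= g x)%E ->
  (\int[mu]_(x in D) f x <= \int[mu]_(x in D) g x)%E.
Proof.
move=> f0 fg.
have fgD x : ((f \_ D) x <= (g \_ D) x)%E.
  by rewrite !patchE; case: ifPn => // /[!inE] /fg.
have fD0 x : (0 <= (f \_ D) x)%E by apply: erestrict_ge0.
rewrite (integral_mkcond D f) (integral_mkcond D g) !ge0_integralTE//; last first.
  by move=> x; apply: le_trans (fgD x).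
by apply: ereal_sup_le => _ [h hf <-]; exists h => // x; exact: le_trans (fgD x).
Qed.

Lemma sum_nneseries_le (R : realType) (f : nat -> \bar R) (x : \bar R) :
  (forall i, 0 <= f i)%E ->
  (forall n, \sum_(0 <= i < n) f i <= x)%E -> (\sum_(0 <= i <oo) f i <= x)%E.
Proof.
move=> f0 fx; apply: lime_le; first by apply: is_cvg_nneseries => n _ _.
by apply: nearW => n; exact: fx.
Qed.

(** * Hausdorff content: monotonicity, subadditivity, balls *)

Section HausdorffContent.
Variables (R : realType) (d : nat) (beta : R).
Local Notation V := 'rV[R]_d.
Local Notation H := (@hcontent R d beta).
Local Notation w := (omega beta).

Lemma Gamma_ge0 (s : R) : 0 <= Gamma s.
Proof.
apply: fine_ge0; apply: integral_ge0 => x _.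
by rewrite lee_fin mulr_ge0 ?powR_ge0 ?expR_ge0.
Qed.

Lemma omega_ge0 : 0 <= w.
Proof. by rewrite divr_ge0 ?powR_ge0 ?Gamma_ge0. Qed.

Lemma ball_weight_ge0 (r : R) : (0 <= (w * r `^ beta)%:E)%E.
Proof. by rewrite lee_fin mulr_ge0 ?powR_ge0 ?omega_ge0. Qed.

Lemma hcontent_le_cover (E : set V) (x : nat -> V) (r : nat -> R) :
  (forall i, 0 < r i) -> E `<=` \bigcup_i eball (x i) (r i) ->
  (H E <= \sum_(0 <= i <oo) (w * r i `^ beta)%:E)%E.
Proof.
by move=> r0 Ex; apply: ereal_inf_lbound; exists r => //; exists x.
Qed.

Lemma hcontent_ltP (E : set V) (s : \bar R) : (H E < s)%E ->
  exists (x : nat -> V) (r : nat -> R), [/\ forall i, 0 < r i,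
    E `<=` \bigcup_i eball (x i) (r i) &
    (\sum_(0 <= i <oo) (w * r i `^ beta)%:E < s)%E].
Proof.
by move=> /ereal_inf_lt[_ [r [x [r0 Ex]] <-] ?]; exists x, r.
Qed.

Lemma hcontent_ge0 (E : set V) : (0 <= H E)%E.
Proof.
apply: le_ereal_inf_tmp => _ [r _ <-].
by apply: nneseries_ge0 => i _ _; exact: ball_weight_ge0.
Qed.

Lemma le_hcontent (A B : set V) : A `<=` B -> (H A <= H B)%E.
Proof.
move=> AB; apply: ereal_inf_le_tmp => _ [r [x [r0 Bx]] <-].
by exists r => //; exists x; split => //; exact: subset_trans Bx.
Qed.

(** The [n]-th set gets a cover within [e / 2 ^ n.+1] of its content, and these covers are merged
    along a bijection between [nat] and pairs. *)
Lemma hcontent_bigcup (A : nat -> set V) :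
  (H (\bigcup_n A n) <= \sum_(0 <= n <oo) H (A n))%E.
Proof.
have [[i ioo]|] := pselect (exists i, H (A i) = +oo%E).
  rewrite (eseries_pinfty _ _ ioo) ?leey// => n _.
  by rewrite -ltNye (lt_le_trans _ (hcontent_ge0 _)).
rewrite -forallNE => Aoo.
apply/lee_addgt0Pr => e e0.
apply: le_trans (epsilon_trick xpredT _ _); last exact/ltW.
  2: by move=> n; exact: hcontent_ge0.
pose P n (B : (nat -> V) * (nat -> R)) := [/\ forall i, 0 < B.2 i,
    A n `<=` \bigcup_i eball (B.1 i) (B.2 i) &
    (\sum_(0 <= i <oo) (w * B.2 i `^ beta)%:E <=
      H (A n) + (e / (2 ^ n.+1)%:R)%:E)%E].
have [G PG] : {G : nat -> (nat -> V) * (nat -> R) & forall n, P n (G n)}.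
  apply: (@choice _ _ P) => n.
  have : (H (A n) < H (A n) + (e / (2 ^ n.+1)%:R)%:E)%E.
    rewrite lteDl ?lte_fin ?divr_gt0 ?ltr0n ?expn_gt0//.
    by rewrite ge0_fin_numE ?hcontent_ge0// ltey; apply/eqP/Aoo.
  by move=> /hcontent_ltP[x [r [r0 Ax /ltW]]]; exists (x, r).
have /card_esym/ppcard_eqP[f] := card_nat2.
apply: (@le_trans _ _ (\sum_(0 <= k <oo)
    (w * (G (f k).1).2 (f k).2 `^ beta)%:E)%E).
  apply: (@hcontent_le_cover _ (fun k => (G (f k).1).1 (f k).2)
    (fun k => (G (f k).1).2 (f k).2)).
    by move=> k; have [] := PG (f k).1.
  move=> t [n _]; have [_ + _ Ant] := PG n => /(_ _ Ant)[j _ tj].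
  by exists (f^-1%FUN (n, j)) => //=; rewrite invK ?inE.
pose a n j := (w * (G n).2 j `^ beta)%:E.
have a0 n j : (0 <= a n j)%E by exact: ball_weight_ge0.
rewrite (_ : (\sum_(0 <= k <oo) _)%E = (\sum_(0 <= n <oo) \sum_(0 <= j <oo) a n j)%E).
  apply: lee_nneseries => n _; first by move=> _; exact: nneseries_ge0.
  by have [] := PG n.
(* The iterated series is compared through unordered sums, where reindexing by [f] is legitimate. *)
apply: (@etrans _ _ (\esum_(k in [set: nat]) a (f k).1 (f k).2)%E).
  by rewrite -nneseries_esumT// => k; exact: a0.
apply: (@etrans _ _ (\esum_(n in [set: nat]) \esum_(j in [set: nat]) a n j)%E).
  rewrite esum_esum//; apply/esym.
  apply: (reindex_esum [set: nat] ([set: nat] `*`` (fun=> [set: nat])) f).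
  by rewrite (_ : _ `*`` _ = setT) //; apply/seteqP; split.
rewrite -nneseries_esumT; last by move=> n; apply: esum_ge0.
by apply: eq_eseriesr => n _; rewrite nneseries_esumT.
Qed.

(** With weight zero every cover costs nothing, and the balls of radius [i.+1] about the origin
    exhaust the space. This settles the degenerate case without computing [Gamma]. *)
Lemma hcontent_omega_le0 (E : set V) : w <= 0 -> H E = 0%E.
Proof.
move=> w0; have wE : w = 0 by apply/eqP; rewrite eq_le w0 omega_ge0.
apply/eqP; rewrite eq_le hcontent_ge0 andbT.
apply: le_trans (@hcontent_le_cover _ (fun=> 0) (fun i => i.+1%:R) _ _) _.
- by move=> i; rewrite ltr0n.
- move=> y _; exists (Num.trunc (enorm y)) => //.
  by rewrite /eball /= subr0 truncnS_gt.
- by rewrite eseries0// => i _ _; rewrite wE mul0r.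
Qed.

Hypothesis beta_gt0 : 0 < beta.

(** A cover in [hcontent] is an infinite sequence of positive radii, so the ball is completed by
    concentric balls of geometrically decreasing weight; this costs the factor 2. *)
Lemma hcontent_eball (x : V) (E : set V) (rho : R) : 0 < w -> 0 < rho ->
  E `<=` eball x rho -> (H E <= (2 * (w * rho `^ beta))%:E)%E.
Proof.
move=> w0 rho0 Ex; set s := 2 * _.
have s0 : 0 < s by rewrite mulr_gt0 // mulr_gt0 // powR_gt0.
(* The weights are [s / 2 ^ i.+1], with sum [s]; index 0 carries half of [s], which is exactly the
   radius [rho]. *)
pose r i := (s / (2 ^ i.+1)%:R / w) `^ beta^-1.
have q0 i : 0 < s / (2 ^ i.+1)%:R / w.
  by apply: divr_gt0 => //; apply: divr_gt0; rewrite ?ltr0n ?expn_gt0.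
have rE i : w * r i `^ beta = s / (2 ^ i.+1)%:R.
  rewrite /r -powRrM mulVf ?gt_eqF// powRr1 ?ltW// mulrC divfK ?gt_eqF//.
apply: le_trans (epsilon_trick0 xpredT (ltW s0)).
rewrite -(eq_eseriesr (fun i _ => congr1 EFin (rE i))).
apply: (@hcontent_le_cover _ (fun=> x)) => [i|y /Ex Ey].
  by rewrite powR_gt0.
exists 0%N => //; rewrite /r /= expn1.
suff -> : s / 2 / w = rho `^ beta by rewrite -powRrM mulfV ?gt_eqF// powRr1 ?ltW.
rewrite /s; field; rewrite gt_eqF//.
Qed.

(** Since radii are positive, no cover has empty balls; the empty set is instead placed in balls of
    arbitrarily small weight. *)
Lemma hcontent0 : H set0 = 0%E.
Proof.
have [w0|w0] := ltP 0 w; last exact: hcontent_omega_le0.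
apply/eqP; rewrite eq_le hcontent_ge0 andbT; apply/lee_addgt0Pr => e e0.
rewrite add0e.
have q0 : 0 < e / 2 / w by apply: divr_gt0 => //; exact: divr_gt0.
apply: le_trans (@hcontent_eball 0 _ ((e / 2 / w) `^ beta^-1) w0 _ _) _ => //.
  by rewrite powR_gt0.
rewrite lee_fin -powRrM mulVf ?gt_eqF// powRr1; last exact: ltW.
suff -> : 2 * (w * (e / 2 / w)) = e by [].
by field; rewrite gt_eqF.
Qed.

Lemma hcontentU (A B : set V) : (H (A `|` B) <= H A + H B)%E.
Proof.
rewrite -bigcup2E; apply: le_trans (hcontent_bigcup _) _.
rewrite (@nneseries_split _ _ 0 2) ?add0n//; last first.
  by move=> k _; exact: hcontent_ge0.
rewrite eseries0 ?adde0; last by case=> [|[|n]] //= _ _; rewrite hcontent0.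
by rewrite big_nat_recr//= big_nat1.
Qed.

End HausdorffContent.

(** * Affine parametrisation of cubes *)

(** Every [cube U a l] is the image of [unit_cube] under such a map, so estimates can be proved on
    the unit cube and transported. *)
Definition affine (R : realType) (d : nat) (U : 'M[R]_d) (a : 'rV[R]_d) (l : R)
  (y : 'rV[R]_d) : 'rV[R]_d := a + (l *: y) *m U.

Definition unit_cube (R : realType) (d : nat) : set 'rV[R]_d :=
  [set y | forall i, 0 <= y ord0 i <= 1].
Arguments unit_cube {R d}.

Section AffineMaps.
Variables (R : realType) (d : nat).
Local Notation V := 'rV[R]_d.
Implicit Types (U : 'M[R]_d) (a b x y : V) (l s : R).

Lemma cubeE U a l : cube U a l = affine U a l @` unit_cube.
Proof. by []. Qed.

Lemma orthogonal_mx1 : orthogonal_mx (1%:M : 'M[R]_d).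
Proof. by rewrite /orthogonal_mx trmx1 mulmx1. Qed.

Lemma orthogonal_mx_tr U : orthogonal_mx U -> orthogonal_mx U^T.
Proof. by rewrite /orthogonal_mx trmxK; exact: mulmx1C. Qed.

Lemma enormE x : enorm x = Num.sqrt ((x *m x^T) ord0 ord0).
Proof.
by rewrite /enorm mxE; congr Num.sqrt; apply: eq_bigr => i _; rewrite mxE expr2.
Qed.

Lemma enormZ l x : 0 <= l -> enorm (l *: x) = l * enorm x.
Proof.
move=> l0; rewrite !enormE linearZ/= -scalemxAl -scalemxAr scalerA mxE.
by rewrite -expr2 sqrtrM ?sqr_ge0// sqrtr_sqr ger0_norm.
Qed.

Lemma enorm_orthogonal U x : orthogonal_mx U -> enorm (x *m U) = enorm x.
Proof.
move=> oU; rewrite !enormE trmx_mul mulmxA -(mulmxA x).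
by move: oU; rewrite /orthogonal_mx => ->; rewrite mulmx1.
Qed.

Lemma normr_coord_le_enorm x i : `|x ord0 i| <= enorm x.
Proof.
rewrite -sqrtr_sqr ler_wsqrtr// (bigD1 i)//= lerDl.
by apply: sumr_ge0 => j _; exact: sqr_ge0.
Qed.

Lemma enorm_affineB U a l x y : orthogonal_mx U -> 0 <= l ->
  enorm (affine U a l x - affine U a l y) = l * enorm (x - y).
Proof.
move=> oU l0; rewrite -enormZ// -(enorm_orthogonal (l *: _) oU).
by rewrite /affine scalerBr mulmxBl opprD addrACA subrr add0r.
Qed.

Lemma affine0 U a l : affine U a l 0 = a.
Proof. by rewrite /affine scaler0 mul0mx addr0. Qed.

Lemma affine_comp U a l b s y :
  affine U a l (affine 1%:M b s y) = affine U (affine U a l b) (l * s) y.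
Proof. by rewrite /affine mulmx1 scalerDr mulmxDl scalerA addrA. Qed.

Lemma affine_cube U a l b s :
  affine U a l @` cube 1%:M b s = cube U (affine U a l b) (l * s).
Proof.
rewrite !cubeE image_comp; congr (_ @` _).
by apply/funext => y /=; rewrite affine_comp.
Qed.

(** The inverse has the form [affine] again, with the transposed matrix and ratio [l^-1], so bounds
    valid for all these maps apply to it. *)
Lemma affineK U a l : orthogonal_mx U -> l != 0 ->
  cancel (affine U a l) (affine U^T (- ((l^-1 *: a) *m U^T)) l^-1).
Proof.
move=> oU l0 y; rewrite /affine scalerDr mulmxDl addrA addNr add0r.
rewrite scalemxAl scalerA mulVf// scale1r -mulmxA.
by move: oU; rewrite /orthogonal_mx => ->; rewrite mulmx1.
Qed.

Lemma mem_cube1 b s y : 0 < s ->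
  cube 1%:M b s y <-> forall i, b ord0 i <= y ord0 i <= b ord0 i + s.
Proof.
move=> s0; rewrite cubeE; split => [[z Iz <-] i|H].
  rewrite /affine mulmx1 !mxE lerDl lerD2l; have /andP[z0 z1] := Iz i.
  by rewrite mulr_ge0 ?(ltW s0)//= ler_piMr ?(ltW s0).
exists (s^-1 *: (y - b)).
  move=> i; rewrite !mxE; have /andP[h1 h2] := H i.
  by rewrite mulr_ge0 ?subr_ge0 ?invr_ge0 ?(ltW s0)//= ler_pdivrMl// mulr1 lerBlDl.
by rewrite /affine mulmx1 scalerA mulfV ?gt_eqF// scale1r addrC subrK.
Qed.

Lemma unit_cubeE : @unit_cube R d = cube 1%:M 0 1.
Proof.
by apply/seteqP; split => y; rewrite mem_cube1// => H i;
  have := H i; rewrite mxE add0r.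
Qed.

End AffineMaps.

(** * Scaling of the content *)

Section Scaling.
Variables (R : realType) (d : nat) (beta : R).
Local Notation V := 'rV[R]_d.
Local Notation H := (@hcontent R d beta).

(** Orthogonality makes the map a similarity for the Euclidean norm: it sends balls to balls with
    radii multiplied by [l]. *)
Lemma hcontent_affine_le (U : 'M[R]_d) (a : V) (l : R) (E : set V) :
  orthogonal_mx U -> 0 < l ->
  (H (affine U a l @` E) <= (l `^ beta)%:E * H E)%E.
Proof.
move=> oU l0; have lb0 : 0 < l `^ beta by exact: powR_gt0.
rewrite muleC -lee_pdivrMr//; apply: le_ereal_inf_tmp => _ [r [x [r0 Ex]] <-].
rewrite lee_pdivrMr// muleC -nneseriesZl; last first.
  by move=> i _; exact: ball_weight_ge0.
apply: le_trans (@hcontent_le_cover _ _ _ _ (affine U a l \o x)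
  (fun i => l * r i) _ _) _.
- by move=> i; rewrite mulr_gt0.
- move=> _ [y /Ex[i _ /= yi] <-]; exists i => //=; rewrite /eball /=.
  by rewrite enorm_affineB ?ltW// ltr_pM2l.
apply: lee_nneseries => [i _ _|i _]; first exact: ball_weight_ge0.
by rewrite -EFinM lee_fin powRM ?(ltW l0) ?(ltW (r0 i))// mulrCA.
Qed.

Lemma hcontent_affine (U : 'M[R]_d) (a : V) (l : R) (E : set V) :
  orthogonal_mx U -> 0 < l ->
  H (affine U a l @` E) = ((l `^ beta)%:E * H E)%E.
Proof.
move=> oU l0; have lb0 : 0 < l `^ beta by exact: powR_gt0.
apply/eqP; rewrite eq_le hcontent_affine_le//=.
rewrite muleC -lee_pdivlMr//.
rewrite -{1}[E]image_id -[X in X @` E](funext (affineK a oU (lt0r_neq0 l0))).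
rewrite -image_comp; apply: le_trans (hcontent_affine_le _ _ _ _) _.
- exact: orthogonal_mx_tr.
- by rewrite invr_gt0.
- by rewrite muleC -powRN -(powR_inv1 (ltW l0)) -powRrM mulN1r.
Qed.

Lemma hcontent_cube (U : 'M[R]_d) (a : V) (l : R) :
  orthogonal_mx U -> 0 < l ->
  H (cube U a l) = ((l `^ beta)%:E * H unit_cube)%E.
Proof. by move=> oU l0; rewrite cubeE hcontent_affine. Qed.

End Scaling.

(** * The unit cube against balls; lower bound for its content *)

Lemma unit_cube_sub_eball (R : realType) (d : nat) :
  @unit_cube R d `<=` eball 0 d.+1%:R.
Proof.
move=> y Iy; rewrite /eball /= subr0 /enorm.
have d0 : 0 < d.+1%:R :> R by rewrite ltr0n.
rewrite -[ltRHS](gtr0_norm d0) -sqrtr_sqr ltr_sqrt ?exprn_gt0//.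
apply: (@le_lt_trans _ _ (\sum_(i < d) 1)).
  apply: ler_sum => i _; have /andP[y0 y1] := Iy i.
  by rewrite -[leRHS](expr1n _ 2) ler_pXn2r ?nnegrE.
by rewrite sumr_const card_ord -natrX ltr_nat; lia.
Qed.

Section LowerBound.
Variables (R : realType) (d : nat) (beta : R).
Local Notation V := 'rV[R]_d.
Local Notation H := (@hcontent R d beta).
Local Notation w := (omega beta).

(** Row vectors carry the topology of the sup norm, so openness comes from continuity of the
    Euclidean norm. *)
Lemma eball_open (x : V) (r : R) : open (eball x r).
Proof.
pose f (y : V) := \sum_(i < d) (y ord0 i - x ord0 i) ^+ 2.
have fE y : enorm (y - x) = Num.sqrt (f y).
  by congr Num.sqrt; apply: eq_bigr => i _; rewrite !mxE.
rewrite (_ : eball x r = (Num.sqrt \o f) @^-1` [set z | z < r]); last first.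
  by apply/seteqP; split => y; rewrite /eball /= fE.
apply: open_comp; last exact: open_lt.
move=> y _; apply: continuous_comp; last exact: sqrt_continuous.
apply: continuous_big => [|i _ {}y]; first exact: add_continuous.
apply: (@continuous_comp _ _ _ (fun z : V => z ord0 i - x ord0 i)
  (fun t : R => t ^+ 2)); last exact: exprn_continuous.
by apply: continuousB; [exact: coord_continuous|exact: cst_continuous].
Qed.

Lemma unit_cube_compact : compact (@unit_cube R d).
Proof.
have := @rV_compact R d (fun=> [set` `[0%R, 1%R]]) (fun=> @segment_compact R 0 1).
by congr compact; apply/seteqP; split => y Hy i; have := Hy i; rewrite /= in_itv.
Qed.

(** By compactness. The grid argument below needs finitely many balls, since the mesh must be fine
    for all radii at once. *)
Lemma finite_ball_cover (x : nat -> V) (r : nat -> R) :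
  @unit_cube R d `<=` \bigcup_i eball (x i) (r i) ->
  exists n, forall y, @unit_cube R d y -> exists2 i, (i < n)%N & eball (x i) (r i) y.
Proof.
move=> Ex; have := unit_cube_compact; rewrite compact_cover.
move=> /(_ nat setT (fun i => eball (x i) (r i)) (fun i _ => @eball_open (x i) (r i)) Ex).
move=> [D _ DE]; exists (\max_(i <- finmap.enum_fset D) i).+1 => y /DE[i /= iD yi].
by exists i => //; rewrite ltnS; exact: leq_bigmax_seq.
Qed.

(** The members lie within [2 * r * N] of the smallest one, so there are at most [2 * r * N + 1] of
    them; [1 <= r * N] absorbs the extra unit. *)
Lemma card_grid_interval (N : nat) (x r : R) : (0 < N)%N -> 1 <= r * N%:R ->
  #|[pred m : 'I_N | `|m%:R / N%:R - x| < r]|%:R <= 3 * r * N%:R :> R.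
Proof.
move=> N0 rN; have N0R : 0 < N%:R :> R by rewrite ltr0n.
set A := [pred m : 'I_N | _].
have [m0 m0A|A0] := pickP A; last first.
  by rewrite (eq_card A0) card0; lra.
case: (@arg_minnP _ m0 A (@nat_of_ord N) m0A) => m1 Am1 m1min.
have [t0 t1] : (Num.trunc (2 * r * N%:R))%:R <= 2 * r * N%:R :> R /\
  2 * r * N%:R < (Num.trunc (2 * r * N%:R)).+1%:R :> R.
  by apply/andP/truncn_itv; lra.
set p := Num.trunc _ in t0 t1.
have mp (m : 'I_N) : A m -> (m - m1 <= p)%N.
  move=> Am; have mm1 := m1min _ Am; rewrite -ltnS -(ltr_nat R).
  apply: le_lt_trans t1; rewrite natrB//.
  move: Am Am1; rewrite /A /= !ltr_norml => /andP[_ h1] /andP[h2 _].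
  have : m%:R / N%:R - m1%:R / N%:R <= 2 * r by lra.
  by rewrite -mulrBl ler_pdivrMr.
have /card_in_imset cA : {in A &, injective (fun m : 'I_N => inord (m - m1) : 'I_p.+1)}.
  move=> m m' Am Am' /(congr1 (@nat_of_ord _)); rewrite !inordK ?ltnS ?mp// => mm.
  by apply: val_inj; have := m1min _ Am; have := m1min _ Am'; move: mm => /=; lia.
have : (#|A| <= p.+1)%N by rewrite -cA -[leqRHS]card_ord max_card.
by rewrite -(ler_nat R) -natr1; lra.
Qed.

(** The ball lies in a box of half-side [r], where the counts for the coordinates multiply. *)
Lemma card_grid_ball (N : nat) (x : V) (r : R) : (0 < N)%N -> 1 <= r * N%:R ->
  #|[pred g : {ffun 'I_d -> 'I_N} |
      `[< eball x r (\row_i ((g i)%:R / N%:R)) >]]|%:R <= (3 * r * N%:R) ^+ d :> R.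
Proof.
move=> N0 rN.
pose B i := [pred m : 'I_N | `|m%:R / N%:R - x ord0 i| < r].
apply: (@le_trans _ _ (#|family B|%:R)).
  rewrite ler_nat; apply: subset_leq_card; apply/fintype.subsetP => g.
  rewrite -topredE /= => /asboolP gx; apply/familyP => i.
  rewrite -topredE /B /=.
  refine (le_lt_trans _ gx).
  by have := normr_coord_le_enorm (\row_j ((g j)%:R / N%:R) - x) i; rewrite !mxE.
rewrite card_family foldrE big_map big_enum natr_prod.
apply: (@le_trans _ _ (\prod_(i < d) (3 * r * N%:R))); last first.
  by rewrite prodr_const card_ord.
by apply: ler_prod => i _; rewrite ler0n/=; exact: card_grid_interval.
Qed.

(* Grid points [g / N] of the cube: each ball contains at most [(3 r N)^d]
   of the [N^d] points once [N >= 1 / r]. *)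
Lemma finite_ball_cover_sum (n : nat) (x : nat -> V) (r : nat -> R) :
  (forall i, 0 < r i) ->
  (forall y, @unit_cube R d y -> exists2 i, (i < n)%N & eball (x i) (r i) y) ->
  1 <= \sum_(i < n) (3 * r i) ^+ d.
Proof.
move=> r0 cov.
pose N := (\sum_(i < n) (Num.trunc (r i)^-1).+1).+1.
have N0 : 0 < N%:R :> R by rewrite ltr0n.
have rN (i : 'I_n) : 1 <= r i * N%:R.
  rewrite -ler_pdivrMl// mulr1; apply: ltW.
  apply: lt_le_trans (truncnS_gt _) _.
  by rewrite ler_nat /N (bigD1 i)//=; apply: leqW; rewrite leq_addr.
pose A (i : 'I_n) := [pred g : {ffun 'I_d -> 'I_N} |
      `[< eball (x i) (r i) (\row_i ((g i)%:R / N%:R)) >]].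
have : (N ^ d <= \sum_(i < n) #|A i|)%N.
  rewrite -[X in (X ^ _)%N]card_ord -[X in (_ ^ X)%N]card_ord -card_ffun -sum1_card.
  under [leqRHS]eq_bigr do rewrite -sum1_card big_mkcond.
  rewrite exchange_big/=; apply: leq_sum => g _.
  have [|i ni gi] := cov (\row_i ((g i)%:R / N%:R)).
    move=> i; rewrite mxE divr_ge0 ?ler0n//= ler_pdivrMr// mul1r ler_nat.
    exact/ltnW.
  rewrite (bigD1 (Ordinal ni))//= inE ifT//.
  exact/asboolP.
rewrite -(ler_nat R) natrX natr_sum => NA.
rewrite -(ler_pM2r (exprn_gt0 d N0)) mul1r; apply: le_trans NA _.
rewrite mulr_suml; apply: ler_sum => i _; rewrite -exprMn.
exact: card_grid_ball.
Qed.

(** If some [3 * r i] is at least 1, that ball alone suffices. Otherwise all are below 1, and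
    [beta <= d] makes their powers of exponent [beta] dominate those of exponent [d] bounded by the
    grid count. *)
Lemma hcontent_unit_cube_ge : 0 < beta -> beta <= d%:R ->
  ((w * 3^-1 `^ beta)%:E <= H unit_cube)%E.
Proof.
move=> b0 bd; apply: le_ereal_inf_tmp => _ [r [x [r0 cov]] <-].
have [n ncov] := finite_ball_cover cov.
apply: (@le_trans _ _ (\sum_(0 <= i < n) (w * r i `^ beta)%:E)%E); last first.
  by apply: nneseries_lim_ge => i _ _; exact: ball_weight_ge0.
have r30 i : 0 <= 3 * r i by rewrite mulr_ge0// ltW.
have : 1 <= \sum_(i < n) (3 * r i) `^ beta.
  have [[i ri]|small] := pselect (exists i : 'I_n, 1 <= 3 * r i).
    rewrite (bigD1 i)//= ler_wpDr ?sumr_ge0//.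
      by move=> j _; exact: powR_ge0.
    by rewrite -[leLHS](powRr0 (3 * r i)) ler_powR// ltW.
  apply: le_trans (finite_ball_cover_sum r0 ncov) _.
  apply: ler_sum => i _; rewrite -powR_mulrn// ger_powR// mulr_gt0//=.
  by rewrite leNgt; apply/negP => /ltW ri; apply: small; exists i.
rewrite big_mkord sumEFin lee_fin => /(ler_wpM2l (omega_ge0 beta)).
rewrite mulr1 => /(ler_wpM2r (powR_ge0 3^-1 beta)) h; apply: le_trans h _.
rewrite mulr_sumr mulr_suml; apply: ler_sum => i _.
rewrite -mulrA -powRM ?invr_ge0//.
by rewrite (mulrC 3) mulfK.
Qed.

End LowerBound.

(** * Dyadic cubes of the unit cube *)

Section Dyadic.
Variables (R : realType) (d : nat).
Local Notation V := 'rV[R]_d.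
Local Notation address := {ffun 'I_d -> nat}.
Implicit Types (m : address) (k n : nat).

Definition corner k m : V := \row_i ((m i)%:R / 2 ^+ k).
Definition dcube k m : set V := cube 1%:M (corner k m) (2 ^- k).
(** Closed dyadic cubes of one generation share faces; a point of the open cube determines the
    address. *)
Definition dinterior k m : set V :=
  [set y | forall i, (m i)%:R / 2 ^+ k < y ord0 i < (m i).+1%:R / 2 ^+ k].
Definition ancestor n m : address := [ffun i => m i %/ 2 ^ n]%N.
Definition in_unit k m := forall i, (m i < 2 ^ k)%N.

Lemma dcubeP k m y : dcube k m y <->
  forall i, (m i)%:R / 2 ^+ k <= y ord0 i <= (m i).+1%:R / 2 ^+ k.
Proof.
rewrite /dcube mem_cube1 ?invr_gt0 ?exprn_gt0//.
by split => H i; have := H i; rewrite mxE -(natr1 (m i)) mulrDl mul1r.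
Qed.

Lemma ancestor0 m : ancestor 0 m = m.
Proof. by apply/ffunP => i; rewrite ffunE divn1. Qed.

Lemma ancestorD n1 n2 m : ancestor n1 (ancestor n2 m) = ancestor (n1 + n2) m.
Proof. by apply/ffunP => i; rewrite !ffunE -divnMA -expnD addnC. Qed.

Lemma in_unit_ancestor n k m : (n <= k)%N -> in_unit k m ->
  in_unit (k - n) (ancestor n m).
Proof.
move=> nk um i; rewrite ffunE ltn_divLR ?expn_gt0//.
by rewrite -expnD subnK.
Qed.

Lemma ancestor_bounds n k (a : nat) : (n <= k)%N ->
  (a %/ 2 ^ n)%:R / 2 ^+ (k - n) <= a%:R / 2 ^+ k :> R /\
  a.+1%:R / 2 ^+ k <= (a %/ 2 ^ n).+1%:R / 2 ^+ (k - n) :> R.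
Proof.
move=> nk; have p0 j : 0 < 2 ^+ j :> R by exact: exprn_gt0.
have -> : 2 ^+ k = 2 ^+ (k - n) * 2 ^+ n :> R by rewrite -exprD subnK.
rewrite !invfM !mulrA [_ / 2 ^+ (k - n) / _]mulrAC [X in _ /\ X <= _]mulrAC.
rewrite !ler_pM2r ?invr_gt0// ler_pdivlMr// ler_pdivrMr// -!natrX -!natrM !ler_nat.
split; first exact: leq_divM.
by rewrite ltn_ceil// expn_gt0.
Qed.

Lemma dcube_sub_ancestor n k m : (n <= k)%N ->
  dcube k m `<=` dcube (k - n) (ancestor n m).
Proof.
move=> nk y /dcubeP ym; apply/dcubeP => i; rewrite ffunE.
have /andP[y0 y1] := ym i; have [h0 h1] := ancestor_bounds (m i) nk.
by rewrite (le_trans h0)// (le_trans y1).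
Qed.

Lemma dinterior_sub_ancestor n k m : (n <= k)%N ->
  dinterior k m `<=` dinterior (k - n) (ancestor n m).
Proof.
move=> nk y ym i; rewrite ffunE.
have /andP[y0 y1] := ym i; have [h0 h1] := ancestor_bounds (m i) nk.
by rewrite (le_lt_trans h0)// (lt_le_trans y1).
Qed.

Lemma dinterior_inj k m m' y : dinterior k m y -> dcube k m' y -> m = m'.
Proof.
move=> ym /dcubeP ym'; apply/ffunP => i.
have /andP[a0 a1] := ym i; have /andP[b0 b1] := ym' i.
have p0 : 0 < 2 ^- k :> R by rewrite invr_gt0 exprn_gt0.
have := lt_le_trans a0 b1; rewrite ltr_pM2r// ltr_nat ltnS => h1.
have := le_lt_trans b0 a1; rewrite ltr_pM2r// ltr_nat ltnS => h2.
by apply/eqP; rewrite eqn_leq h1.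
Qed.

Lemma dinterior_sub k m : dinterior k m `<=` dcube k m.
Proof. by move=> y ym; apply/dcubeP => i; have /andP[/ltW-> /ltW->] := ym i. Qed.

Lemma dcube_sub_unit k m : in_unit k m -> dcube k m `<=` unit_cube.
Proof.
move=> um y /dcubeP ym i; have /andP[y0 y1] := ym i.
rewrite (le_trans _ y0) ?divr_ge0 ?exprn_ge0 ?ler0n//=.
apply: le_trans y1 _; rewrite ler_pdivrMr ?exprn_gt0// mul1r -natrX ler_nat.
exact: um.
Qed.

End Dyadic.

(** * Selection of stopping cubes *)

Section StoppingTime.
Variables (R : realType) (d : nat) (beta : R).
Local Notation address := {ffun 'I_d -> nat}.

Definition side_pow (k : nat) : R := (2 ^- k) `^ beta.

Lemma side_pow_gt0 k : 0 < side_pow k.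
Proof. by rewrite powR_gt0// invr_gt0 exprn_gt0. Qed.

(** At most one term is nonzero. It expresses that a covering cube is counted by at most one
    stopping cube. *)
Lemma sum_indic_le (P : pred nat) (n : nat) (x : \bar R) : (0 <= x)%E ->
  (forall i j, P i -> P j -> i = j) ->
  (\sum_(0 <= i < n) (if P i then x else 0) <= x)%E.
Proof.
move=> x0 Puniq; elim: n => [|n IH]; first by rewrite big_geq.
rewrite big_nat_recr//=; case: ifPn => [Pn|_]; last by rewrite adde0.
rewrite big_nat big1 ?add0e// => i /andP[_ ni].
by case: ifPn => // Pi; move: ni; rewrite (Puniq _ _ Pi Pn) ltnn.
Qed.

(* The stopping cubes are the maximal dyadic ancestors [S] of the given cubes
   with [sum_(R_i in S) l(R_i)^beta >= theta l(S)^beta].  The left-hand side is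
   additive over disjoint [S], which the content is not, and the parent of a
   stopping cube violates the inequality. *)
Lemma stopping_cubes (k : nat -> nat) (m : nat -> address) (theta : R) :
  0 < theta -> theta <= 1 -> (forall i, in_unit (k i) (m i)) ->
  (\sum_(0 <= i <oo) (side_pow (k i))%:E < theta%:E)%E ->
  exists (f : nat -> bool) (K : nat -> nat) (M : nat -> address),
  [/\ forall j, in_unit (K j).+1 (M j),
      forall i, exists2 j, f j &
        @dcube R d (k i) (m i) `<=` dcube (K j).+1 (M j),
      (theta%:E * \sum_(0 <= j <oo) (if f j then (side_pow (K j).+1)%:E else 0)
        <= \sum_(0 <= i <oo) (side_pow (k i))%:E)%E &
      forall j, exists2 D : pred nat,
        forall i y, @dinterior R d (K j) (ancestor 1 (M j)) y ->
          dcube (k i) (m i) y -> D i &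
        (\sum_(0 <= i <oo) (if D i then (side_pow (k i))%:E else 0)
          <= (theta * side_pow (K j))%:E)%E].
Proof.
move=> th0 th1 um small.
have sp0 j : (0 <= (side_pow j)%:E)%E by rewrite lee_fin ltW// side_pow_gt0.
(* [desc n M i] says that the [i]-th given cube descends from the cube of generation [n] and address
   [M]; [mu] is the total weight of these descendants. *)
pose desc n (M : address) i := (n <= k i)%N && (ancestor (k i - n) (m i) == M).
pose mu n M := (\sum_(0 <= i <oo) (if desc n M i then (side_pow (k i))%:E else 0))%E.
have t0 n M i : (0 <= if desc n M i then (side_pow (k i))%:E else 0)%E.
  by case: ifP.
pose good n M := ((theta * side_pow n)%:E <= mu n M)%E.
have good_self i : good (k i) (m i).
  apply: (@le_trans _ _ (\sum_(0 <= j < i.+1)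
      (if desc (k i) (m i) j then (side_pow (k j))%:E else 0))%E); last first.
    by apply: nneseries_lim_ge => j _ _.
  rewrite big_nat_recr//= {2}/desc leqnn subnn ancestor0 eqxx/=.
  apply: (@le_trans _ _ (side_pow (k i))%:E).
    by rewrite lee_fin ler_piMl// ltW// side_pow_gt0.
  by rewrite leeDr//; apply: sume_ge0 => j _.
(* The whole unit cube is not good, so every stopping cube has a parent inside it. *)
have good0 M : ~~ good 0%N M.
  rewrite -ltNge; apply: le_lt_trans (lt_le_trans small _).
    by apply: lee_nneseries => [j _ _|j _]; [exact: t0|case: ifP].
  by rewrite /side_pow expr0 invr1 powR1 mulr1.
have exK j : exists n, (n <= k j)%N && good n (ancestor (k j - n) (m j)).
  by exists (k j); rewrite leqnn subnn ancestor0 good_self.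
(* The least good generation gives the largest good ancestor. *)
pose K j := ex_minn (exK j).
pose M j := ancestor (k j - K j) (m j).
have Kk j : (K j <= k j)%N by rewrite /K; case: ex_minnP => n /andP[].
have Kgood j : good (K j) (M j) by rewrite /M /K; case: ex_minnP => n /andP[].
have Kmin j n : (n <= k j)%N -> good n (ancestor (k j - n) (m j)) -> (K j <= n)%N.
  by move=> nk ng; rewrite /K; case: ex_minnP => n' _; apply; rewrite nk.
have Kpos j : (0 < K j)%N.
  by rewrite lt0n; apply/eqP => K0; have := Kgood j; rewrite K0 (negbTE (good0 _)).
have KE j : (K j).-1.+1 = K j by rewrite prednK.
have descM i j n : (n <= K j)%N -> desc (K j) (M j) i ->
    ancestor (k i - n) (m i) = ancestor (k j - n) (m j).
  move=> nK /andP[Kki /eqP miE].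
  have -> : (k i - n = (K j - n) + (k i - K j))%N by lia.
  rewrite -ancestorD miE ancestorD; congr ancestor.
  by have := Kk j; lia.
(* A given cube inside the stopping cube of [j] has that same stopping cube: above it the two chains
   of ancestors agree, and minimality applies both ways. *)
have desc_uniq i j : desc (K j) (M j) i -> (K i, M i) = (K j, M j).
  move=> dij; have /andP[Kki /eqP miE] := dij.
  have KiKj : (K i <= K j)%N by apply: Kmin => //; rewrite miE.
  have MiE : M i = ancestor (k j - K i) (m j) by rewrite -(descM i).
  have KjKi : (K j <= K i)%N.
    apply: Kmin; first exact: leq_trans KiKj (Kk j).
    by rewrite -MiE.
  have KK : K i = K j by apply/eqP; rewrite eqn_leq KiKj.
  by rewrite MiE KK.
(* Several given cubes may share a stopping cube; [f] keeps the first index, so that each is listed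
   once. *)
pose f j := all (fun i => (K i, M i) != (K j, M j)) (iota 0 j).
have f_ex j : exists2 i, f i & (K i, M i) = (K j, M j).
  have ex : exists i, (K i, M i) == (K j, M j) by exists j.
  exists (ex_minn ex); case: ex_minnP => i /eqP iE imin //.
  apply/allP => i'; rewrite mem_iota add0n => /= i'i; rewrite iE.
  by apply: contraTN i'i => /imin; rewrite -leqNgt.
have f_uniq i j : f i -> f j -> (K i, M i) = (K j, M j) -> i = j.
  move=> /allP fi /allP fj ij; case: (ltngtP i j) => // lij.
    by have := fj i; rewrite mem_iota add0n lij ij eqxx => /(_ isT).
  by have := fi j; rewrite mem_iota add0n lij ij eqxx => /(_ isT).
(* The witness is the generation of the parent, one less than that of the stopping cube. *)
exists f, (fun j => (K j).-1), M; split.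
- move=> j; rewrite KE /M.
  have := in_unit_ancestor (leq_subr (K j) (k j)) (um j).
  by rewrite subKn.
- move=> i; have [j fj [KK MM]] := f_ex i; exists j => //.
  rewrite KE KK MM /M.
  have := @dcube_sub_ancestor R _ _ _ (m i) (leq_subr (K i) (k i)).
  by rewrite subKn.
- rewrite -nneseriesZl; last by move=> j _; case: ifP.
  apply: sum_nneseries_le => [j|n].
    by apply: mule_ge0; [rewrite lee_fin ltW|case: ifP].
  apply: (@le_trans _ _ (\sum_(0 <= j < n) \sum_(0 <= i <oo)
      (if f j && desc (K j) (M j) i then (side_pow (k i))%:E else 0))%E).
    apply: lee_sum => j _; rewrite KE; case: (f j) => /=; last first.
      by rewrite mule0 eseries0.
    by rewrite -EFinM; exact: Kgood.
  rewrite -nneseries_sum_nat; last by move=> ? ?; case: ifP.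
  apply: lee_nneseries => [i _ _|i _].
    by apply: sume_ge0 => j _; case: ifP.
  apply: sum_indic_le => // j j' /andP[fj /desc_uniq dj] /andP[fj' /desc_uniq dj'].
  by apply: f_uniq => //; rewrite -dj.
- move=> j; set P := ancestor 1 (M j).
  have PE : P = ancestor (k j - (K j).-1) (m j).
    rewrite /P /M ancestorD; congr ancestor.
    by have := Kk j; have := Kpos j; lia.
  have Kj1 : ((K j).-1 <= k j)%N by apply: leq_trans (Kk j); exact: leq_pred.
  exists (desc (K j).-1 P).
  + move=> i y yP yi; rewrite /desc; have [Kki|kiK] := leqP (K j).-1 (k i).
      have := @dcube_sub_ancestor R _ _ _ (m i) (leq_subr (K j).-1 (k i)) _ yi.
      by rewrite subKn// => /(dinterior_inj yP)<-; rewrite eqxx.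
    (* A given cube strictly larger than [P] that meets its interior would contain [P]; being good
       itself, it contradicts the minimality of [K j]. *)
    have := @dinterior_sub_ancestor R _ _ _ P (leq_subr (k i) (K j).-1) _ yP.
    rewrite subKn ?(ltnW kiK)// => /dinterior_inj /(_ yi) Pmi.
    suff : (K j <= k i)%N by have := Kpos j; lia.
    apply: Kmin; first by apply: leq_trans Kj1; exact: ltnW.
    have -> : (k j - k i = ((K j).-1 - k i) + (k j - (K j).-1))%N by lia.
    by rewrite -ancestorD -PE Pmi.
  + apply/ltW; rewrite ltNge; apply/negP => gP.
    have : (K j <= (K j).-1)%N by apply: Kmin => //; rewrite -PE.
    by have := Kpos j; lia.
Qed.

End StoppingTime.

(** * From ball covers to dyadic covers *)

Section DyadicCover.
Variables (R : realType) (d : nat) (beta : R).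
Local Notation V := 'rV[R]_d.
Local Notation H := (@hcontent R d beta).
Local Notation w := (omega beta).
Local Notation address := {ffun 'I_d -> nat}.

(** Each ball is replaced by [p] cubes indexed by a block of [p] consecutive integers, so each
    weight is repeated [p] times. *)
Lemma nneseries_divn (f : nat -> \bar R) (p : nat) : (0 < p)%N ->
  (forall i, 0 <= f i)%E ->
  (\sum_(0 <= j <oo) f (j %/ p)%N <= \sum_(0 <= l < p) \sum_(0 <= i <oo) f i)%E.
Proof.
move=> p0 f0; rewrite -nneseries_sum_nat//.
apply: sum_nneseries_le => // n.
apply: (@le_trans _ _ (\sum_(0 <= j < n * p) f (j %/ p)%N)%E).
  by apply: lee_sum_nneg_natr => //; exact: leq_pmulr.
suff -> : (\sum_(0 <= j < n * p) f (j %/ p)%N = \sum_(0 <= i < n) \sum_(0 <= l < p) f i)%E.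
  by apply: nneseries_lim_ge => i _ _; exact: sume_ge0.
elim: n => [|n IH]; first by rewrite !big_geq.
rewrite (@big_cat_nat _ _ _ (n * p)%N)//=; last by rewrite leq_mul2r leqnSn orbT.
rewrite IH big_nat_recr//=; congr (_ + _)%E.
rewrite mulSn -{1}[(n * p)%N]add0n big_addn addnK.
rewrite [LHS]big_nat [RHS]big_nat; apply: eq_bigr => l /andP[_ lp].
by rewrite addnC divnMDl// divn_small// addn0.
Qed.

(** Take the generation just before the first [n] with [2 ^- n < 2 * r]; the bound [r < 2^-1]
    ensures that this first [n] is not 0. *)
Lemma dyadic_scale (r : R) : 0 < r -> r < 2^-1 ->
  exists2 k, 2 * r <= 2 ^- k & 2 ^- k <= 4 * r.
Proof.
move=> r0 r1; have p0 n : 0 < 2 ^+ n :> R by exact: exprn_gt0.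
have ex : exists n, 2 ^- n < 2 * r.
  exists (Num.trunc (2 * r)^-1).+1; rewrite invf_plt ?posrE ?mulr_gt0//.
  apply: lt_le_trans (truncnS_gt _) _.
  by rewrite -natrX ler_nat ltnW// ltn_expl.
case: (ex_minnP ex) => -[|n] nlt nmin; first by rewrite expr0 invr1 in nlt; lra.
exists n; first by rewrite leNgt; apply/negP => /nmin; rewrite ltnn.
by move: nlt; rewrite exprS invfM; lra.
Qed.

(** The cap sends [t = 1] to the last cell instead of one outside the unit interval. *)
Definition cell (k : nat) (t : R) : nat := minn (Num.trunc (t * 2 ^+ k)) (2 ^ k).-1.

Lemma cell_bounds k t : 0 <= t <= 1 ->
  (cell k t)%:R / 2 ^+ k <= t <= (cell k t).+1%:R / 2 ^+ k.
Proof.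
move=> /andP[t0 t1]; have p0 : 0 < 2 ^+ k :> R by exact: exprn_gt0.
have p0' : (0 < 2 ^ k)%N by rewrite expn_gt0.
rewrite ler_pdivrMr// ler_pdivlMr//.
have tk0 : 0 <= t * 2 ^+ k by rewrite mulr_ge0// ltW.
have /andP[h0 h1] := truncn_itv tk0; apply/andP; split.
  by apply: le_trans h0; rewrite ler_nat geq_minl.
rewrite /cell; case: leqP => _; first exact: ltW.
by rewrite prednK// natrX ler_piMl// ltW.
Qed.

Lemma cell_lt k t : (cell k t < 2 ^ k)%N.
Proof. by rewrite (leq_ltn_trans (geq_minr _ _))// prednK// expn_gt0. Qed.

Lemma cell_near k t t' : 0 <= t -> 0 <= t' -> `|t - t'| < 2 ^- k ->
  (cell k t <= (cell k t').+1)%N.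
Proof.
move=> t0 t'0; have p0 : 0 < 2 ^+ k :> R by exact: exprn_gt0.
rewrite ltr_norml => /andP[_ tt].
have tt1 : t * 2 ^+ k < t' * 2 ^+ k + 1.
  by rewrite -ltrBlDl -mulrBl -ltr_pdivlMr// div1r.
have /andP[h0 h1] := truncn_itv (mulr_ge0 t0 (ltW p0)).
have /andP[h2 h3] := truncn_itv (mulr_ge0 t'0 (ltW p0)).
have : (Num.trunc (t * 2 ^+ k) < (Num.trunc (t' * 2 ^+ k)).+2)%N.
  by rewrite -(ltr_nat R) -natr1; lra.
by rewrite /cell; set a := Num.trunc _; set b := Num.trunc _; lia.
Qed.

(** Two points of the ball differ by less than [2 * r <= 2 ^- k] in each coordinate, so their cells
    differ by at most one: three choices per coordinate. *)
Lemma ball_dcubes (x : V) (r : R) : 0 < r -> r < 2^-1 ->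
  exists (k : nat) (c : nat -> address), [/\ forall n, in_unit k (c n),
    forall y, unit_cube y -> eball x r y ->
      exists2 n, (n < 3 ^ d)%N & dcube k (c n) y &
    2 ^- k <= 4 * r].
Proof.
move=> r0 r1; have [k rk kr] := dyadic_scale r0 r1; exists k.
have [[y0 Iy0 xy0]|none] := pselect (exists2 y, unit_cube y & eball x r y); last first.
  exists (fun=> [ffun=> 0%N]); split => //.
    by move=> n i; rewrite ffunE expn_gt0.
  by move=> y Iy xy; exfalso; apply: none; exists y.
pose m0 i := cell k (y0 ord0 i).
pose T := {ffun 'I_d -> 'I_3}.
(* The shift [g i - 1] ranges over -1, 0, 1; the predecessor at 0 and the minimum keep the address
   inside the unit cube. *)
pose cand (g : T) : address := [ffun i => minn (m0 i + g i).-1 (2 ^ k).-1].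
have g0 : T by exact: [ffun=> ord0].
exists (fun n => cand (nth g0 (enum T) n)); split => //.
  move=> n i; rewrite ffunE (leq_ltn_trans (geq_minr _ _))//.
  by rewrite prednK// expn_gt0.
move=> y Iy xy; pose m i := cell k (y ord0 i).
have near i : `|y ord0 i - y0 ord0 i| < 2 ^- k.
  apply: lt_le_trans rk.
  have h1 := le_lt_trans (normr_coord_le_enorm (y - x) i) xy.
  have h2 := le_lt_trans (normr_coord_le_enorm (y0 - x) i) xy0.
  move: h1 h2; rewrite !mxE !ltr_norml => /andP[? ?] /andP[? ?].
  by apply/andP; split; lra.
have y_ge0 i : 0 <= y ord0 i by have /andP[] := Iy i.
have y0_ge0 i : 0 <= y0 ord0 i by have /andP[] := Iy0 i.
have mm0 i : (m i <= (m0 i).+1)%N by exact: cell_near.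
have m0m i : (m0 i <= (m i).+1)%N by apply: cell_near => //; rewrite distrC.
pose g : T := [ffun i => inord ((m i).+1 - m0 i)].
exists (index g (enum T)).
  have : (index g (enum T) < size (enum T))%N by rewrite index_mem mem_enum.
  by rewrite -cardT card_ffun !card_ord.
rewrite nth_index ?mem_enum//; apply/dcubeP => i.
suff -> : cand g i = m i by exact: cell_bounds.
rewrite !ffunE inordK; last by rewrite ltnS leq_subLR; have := mm0 i; lia.
have := m0m i; have := mm0 i; have := cell_lt k (y ord0 i); rewrite -/(m i).
by move: (2 ^ k)%N => p; lia.
Qed.

(** Each ball gives [3 ^ d] cubes of side at most [4 * r i], which accounts for the constant. *)
Lemma dyadic_cover (E : set V) (s : R) : 0 < beta -> 0 < w ->
  E `<=` unit_cube -> (H E < s%:E)%E -> s <= w * 2^-1 `^ beta ->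
  exists (k : nat -> nat) (m : nat -> address), [/\ forall j, in_unit (k j) (m j),
    E `<=` \bigcup_j dcube (k j) (m j) &
    (\sum_(0 <= j <oo) (side_pow beta (k j))%:E
      <= ((3 ^ d)%:R * (4 `^ beta / w * s))%:E)%E].
Proof.
move=> b0 w0 EI /hcontent_ltP[x [r [r0 Ex rs]]] sw.
(* A single ball of radius at least one half would already cost [s]. *)
have r_small i : r i < 2^-1.
  rewrite ltNge; apply/negP => ri.
  have : (s%:E <= \sum_(0 <= i <oo) (w * r i `^ beta)%:E)%E.
    apply: (@le_trans _ _ (\sum_(0 <= j < i.+1) (w * r j `^ beta)%:E)%E); last first.
      by apply: nneseries_lim_ge => j _ _; exact: ball_weight_ge0.
    apply: (@le_trans _ _ (w * r i `^ beta)%:E).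
      rewrite lee_fin (le_trans sw)// ler_wpM2l ?omega_ge0//.
      by apply: ge0_ler_powR; rewrite ?nnegrE ?invr_ge0// ltW.
    rewrite big_nat_recr//= leeDr//.
    by apply: sume_ge0 => j _; exact: ball_weight_ge0.
  by rewrite leNgt rs.
pose P i (kc : nat * (nat -> address)) := [/\ forall n, in_unit kc.1 (kc.2 n),
    forall y, unit_cube y -> eball (x i) (r i) y ->
      exists2 n, (n < 3 ^ d)%N & dcube kc.1 (kc.2 n) y &
    2 ^- kc.1 <= 4 * r i].
have [G PG] : {G : nat -> nat * (nat -> address) & forall i, P i (G i)}.
  apply: (@choice _ _ P) => i.
  by have [k [c [? ? ?]]] := ball_dcubes (x i) (r0 i) (r_small i); exists (k, c).
have p0 : (0 < 3 ^ d)%N by rewrite expn_gt0.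
exists (fun j => (G (j %/ 3 ^ d)%N).1), (fun j => (G (j %/ 3 ^ d)%N).2 (j %% 3 ^ d)%N).
split.
- by move=> j; have [] := PG (j %/ 3 ^ d)%N.
- move=> y Ey; have [i _ xy] := Ex _ Ey; have [_ + _] := PG i.
  move=> /(_ _ (EI _ Ey) xy)[n np yn]; exists (i * 3 ^ d + n)%N => //.
  by rewrite divnMDl// modnMDl divn_small// modn_small// addn0.
apply: le_trans (@nneseries_divn (fun i => (side_pow beta (G i).1)%:E) _ p0 _) _.
  by move=> i; rewrite lee_fin ltW// side_pow_gt0.
apply: (@le_trans _ _ (\sum_(0 <= l < 3 ^ d) (4 `^ beta / w * s)%:E)%E); last first.
  by rewrite sumEFin lee_fin sumr_const_nat subn0 mulr_natl.
apply: lee_sum => l _.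
apply: (@le_trans _ _ (\sum_(0 <= i <oo) ((4 `^ beta / w)%:E * (w * r i `^ beta)%:E))%E).
  apply: lee_nneseries => i _; first by rewrite lee_fin ltW// side_pow_gt0.
  have [_ _ kr] := PG i; rewrite -EFinM lee_fin mulrA divfK ?gt_eqF//.
  rewrite -powRM ?(ltW (r0 i))//; apply: ge0_ler_powR => //; rewrite ?nnegrE.
  - exact: ltW.
  - by rewrite invr_ge0 exprn_ge0.
  - by rewrite mulr_ge0// ltW.
rewrite nneseriesZl; last by move=> i _; exact: ball_weight_ge0.
rewrite [leRHS]EFinM lee_pmul2l//; first exact: ltW.
by rewrite lte_fin divr_gt0// powR_gt0.
Qed.

End DyadicCover.

(** * Weak-type oscillation bounds *)

Section WeakOscillation.
Variables (R : realType) (d : nat) (beta : R).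
Local Notation V := 'rV[R]_d.
Local Notation H := (@hcontent R d beta).
Local Notation w := (omega beta).

(** The Chebyshev form of bounded mean oscillation, which is all that the iteration uses. The centre
    [c b s] depends on the cube but not on [lam]. *)
Definition weak_bmo (Q0 : set V) (U : 'M[R]_d) (M : R) (v : V -> R)
    (c : V -> R -> R) :=
  forall (b : V) (s : R), 0 < s -> cube U b s `<=` Q0 ->
  forall lam : R, 0 < lam ->
    (lam%:E * H [set x | cube U b s x /\ (lam < `|v x - c b s|)%R]
      <= (M * s `^ beta)%:E)%E.

Lemma affine_set (U : 'M[R]_d) (a : V) (l : R) (A P : set V) :
  affine U a l @` [set y | A y /\ P (affine U a l y)] =
  [set x | (affine U a l @` A) x /\ P x].
Proof.
apply/seteqP; split => [_ [y [Ay Py] <-]|_ [[y Ay <-] Py]].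
  by split => //; exists y.
by exists y.
Qed.

(** Both sides scale by the same power of [l], so [M] is preserved; this lets an induction on the
    unit cube be applied inside a stopping cube. *)
Lemma weak_bmo_rescale Q0 U M v c (a : V) (l : R) : orthogonal_mx U ->
  weak_bmo Q0 U M v c -> 0 < l -> cube U a l `<=` Q0 ->
  weak_bmo unit_cube 1%:M M (v \o affine U a l)
    (fun b s => c (affine U a l b) (l * s)).
Proof.
move=> oU vM l0 aQ b s s0 bI lam lam0.
have lb0 : 0 < l `^ beta by exact: powR_gt0.
have bQ : cube U (affine U a l b) (l * s) `<=` Q0.
  by apply: subset_trans aQ; rewrite -affine_cube; exact: image_subset bI.
have := vM _ _ (mulr_gt0 l0 s0) bQ _ lam0.
rewrite -affine_cube.
rewrite -(affine_set U a l (cube 1%:M b s)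
  [set x | lam < `|v x - c (affine U a l b) (l * s)|]).
rewrite hcontent_affine// muleCA powRM ?(ltW l0) ?(ltW s0)//.
by rewrite mulrCA [leRHS]EFinM lee_pmul2l// lte_fin.
Qed.

Lemma hcontent_avoid (A B1 B2 : set V) : 0 < beta ->
  (H B1 + H B2 < H A)%E -> exists x, [/\ A x, ~ B1 x & ~ B2 x].
Proof.
move=> b0 BA; apply: contrapT => none.
suff /(le_hcontent beta) AB : A `<=` B1 `|` B2.
  have := le_lt_trans (le_trans AB (hcontentU b0 _ _)) BA.
  by rewrite ltxx.
move=> x Ax; apply: contrapT => /not_orP[? ?]; apply: none; by exists x.
Qed.

End WeakOscillation.

(** * Iteration over stopping cubes *)

Section Decay.
Variables (R : realType) (d : nat) (beta : R).
Local Notation V := 'rV[R]_d.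
Local Notation H := (@hcontent R d beta).
Local Notation w := (omega beta).
Local Notation sp := (side_pow beta).
Hypotheses (beta_gt0 : 0 < beta) (beta_le : beta <= d%:R) (w_gt0 : 0 < w).

Definition unit_content : R := fine (H unit_cube).
Local Notation K1 := unit_content.
(** Half the lower bound for the relative content of the interior of a cube: [E] may take one half,
    and the exceptional set of the parent stays below the other. *)
Local Notation theta := (2^-1 `^ beta / 2 : R).

Lemma hcontent_unit_cube : H unit_cube = K1%:E.
Proof.
rewrite fineK// ge0_fin_numE ?hcontent_ge0//.
apply: le_lt_trans (hcontent_eball beta_gt0 w_gt0 _ (@unit_cube_sub_eball R d)) _.
  by rewrite ltr0n.
exact: ltry.
Qed.

Lemma unit_content_gt0 : 0 < K1.
Proof.
rewrite -lte_fin -hcontent_unit_cube.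
apply: lt_le_trans (hcontent_unit_cube_ge beta_gt0 beta_le).
by rewrite lte_fin mulr_gt0// powR_gt0.
Qed.

Lemma hcontent_dcube k m : H (dcube k m) = (sp k * K1)%:E.
Proof.
rewrite hcontent_cube ?invr_gt0 ?exprn_gt0//; last exact: orthogonal_mx1.
by rewrite hcontent_unit_cube EFinM.
Qed.

(** The open cube contains the concentric closed cube of half the side. *)
Lemma hcontent_dinterior k m :
  ((sp k * (2^-1 `^ beta * K1))%:E <= H (dinterior k m))%E.
Proof.
have p0 : 0 < 2 ^- k :> R by rewrite invr_gt0 exprn_gt0.
have h0 : 0 < 2 ^- k * 2^-1 :> R by rewrite mulr_gt0// invr_gt0.
pose a : V := \row_i ((m i)%:R / 2 ^+ k + 2 ^- k / 4).
apply: (@le_trans _ _ (H (cube 1%:M a (2 ^- k * 2^-1)))); last first.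
  apply: le_hcontent => y; rewrite mem_cube1// => ya i.
  have := ya i; rewrite mxE -(natr1 (m i)) mulrDl mul1r.
  by move: p0; set z := (m i)%:R / _; set e := 2 ^- k; lra.
rewrite hcontent_cube//; last exact: orthogonal_mx1.
by rewrite hcontent_unit_cube -EFinM lee_fin mulrA /side_pow powRM ?invr_ge0.
Qed.

Section Step.
Variable q : R.
(** [q1] keeps exceptional sets from filling a cube, [q2] permits the dyadic cover, and [q3] makes
    its total weight at most [theta / 2], whence the factor one half for the stopping cubes. *)
Hypotheses (q_gt0 : 0 < q) (q1 : q < 2^-1 `^ beta * K1 / 2)
  (q2 : 2 * q <= w * 2^-1 `^ beta)
  (q3 : (3 ^ d)%:R * (4 `^ beta / w * (2 * q)) <= theta / 2).

Variables (M lam : R).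
Hypotheses (lam_gt0 : 0 < lam) (M_le : M <= q * lam).

Lemma weak_bmo_level v c b s : weak_bmo beta (@unit_cube R d) 1%:M M v c ->
  0 < s -> cube 1%:M b s `<=` @unit_cube R d ->
  (H [set x | cube 1%:M b s x /\ (lam < `|v x - c b s|)%R]
    <= (q * s `^ beta)%:E)%E.
Proof.
move=> vM s0 bI; have h := vM b s s0 bI lam lam_gt0.
rewrite -(@lee_pmul2l _ lam%:E) ?lte_fin//; apply: le_trans h _.
by rewrite -EFinM lee_fin mulrCA mulrA ler_wpM2r ?powR_ge0// mulrC.
Qed.

Lemma half_powR_bounds : 0 < 2^-1 `^ beta :> R /\ 2^-1 `^ beta <= 1 :> R.
Proof.
split; first by rewrite powR_gt0// invr_gt0.
have : 2^-1 `^ beta <= 1 `^ beta :> R.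
  apply: ge0_ler_powR; rewrite ?nnegrE ?invr_ge0//; first exact: ltW.
  by rewrite invf_le1 ?ler1n.
by rewrite powR1.
Qed.

(* The oscillation at a stopping cube [S] is compared with that of [Q] through
   the parent [P] of [S], where both exceptional sets are too small to fill
   [P]. *)
Lemma calderon_zygmund v c : weak_bmo beta (@unit_cube R d) 1%:M M v c ->
  exists (f : nat -> bool) (k : nat -> nat) (m : nat -> {ffun 'I_d -> nat}),
  [/\ forall j, in_unit (k j) (m j),
      forall y, unit_cube y -> lam < `|v y - c 0 1| ->
        exists2 j, f j & dcube (k j) (m j) y,
      (\sum_(0 <= j <oo) (if f j then (sp (k j))%:E else 0) <= (2^-1)%:E)%E &
      forall j, `|c (corner R (k j) (m j)) (2 ^- k j) - c 0 1| <= 4 * lam].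
Proof.
move=> vM; have [h0 h1] := half_powR_bounds; have K0 := unit_content_gt0.
have th0 : 0 < theta by lra.
have th1 : theta <= 1 by lra.
have q0 := q_gt0; have lam0 := lam_gt0.
pose E : set V := [set y | unit_cube y /\ lam < `|v y - c 0 1|].
(* The factor 2 provides the strict inequality required by [dyadic_cover]. *)
have HE : (H E < (2 * q)%:E)%E.
  have qq : q < 2 * q by lra.
  apply: (@le_lt_trans _ _ q%:E); last by rewrite lte_fin.
  have := @weak_bmo_level v c 0 1 vM ltr01.
  by rewrite -unit_cubeE powR1 mulr1; exact.
have [k0 [m0 [um0 Ecov sum0]]] :=
  dyadic_cover beta_gt0 w_gt0 (fun y (Ey : E y) => proj1 Ey) HE q2.
have {}sum0 : (\sum_(0 <= i <oo) (sp (k0 i))%:E <= (theta / 2)%:E)%E.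
  by apply: le_trans sum0 _; rewrite lee_fin.
have sum_lt : (\sum_(0 <= i <oo) (sp (k0 i))%:E < theta%:E)%E.
  have th2 : theta / 2 < theta by lra.
  by apply: le_lt_trans sum0 _; rewrite lte_fin.
have [f [k [m [um cov sumf par]]]] := stopping_cubes th0 th1 um0 sum_lt.
exists f, (fun j => (k j).+1), m; split => //.
- move=> y Iy yl; have [i _ yi] := Ecov y (conj Iy yl).
  by have [j fj /(_ _ yi)] := cov i; exists j.
- rewrite -(@lee_pmul2l _ theta%:E) ?lte_fin//.
  exact: le_trans sumf sum0.
move=> j; set kS := (k j).+1; set P := ancestor 1 (m j).
have uP : in_unit (k j) P.
  by have := @in_unit_ancestor _ 1 (k j).+1 _ isT (um j); rewrite subn1.
have pos n : 0 < 2 ^- n :> R by rewrite invr_gt0 exprn_gt0.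
have SP : dcube kS (m j) `<=` @dcube R d (k j) P.
  by have := @dcube_sub_ancestor R d 1 kS (m j) isT; rewrite subn1.
set cP := c (corner R (k j) P) (2 ^- k j).
set cS := c (corner R kS (m j)) (2 ^- kS).
pose FP : set V := [set x | dcube (k j) P x /\ lam < `|v x - cP|].
pose FS : set V := [set x | dcube kS (m j) x /\ lam < `|v x - cS|].
have HFP : (H FP <= (q * sp (k j))%:E)%E.
  by apply: (weak_bmo_level vM (pos _)); exact: dcube_sub_unit uP.
have HFS : (H FS <= (q * sp kS)%:E)%E.
  by apply: (weak_bmo_level vM (pos _)); exact: dcube_sub_unit (um j).
have spS : sp kS = sp (k j) * 2^-1 `^ beta.
  by rewrite /side_pow -powRM ?invr_ge0 ?(ltW (pos _))// /kS exprSr invfM.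
have spP0 : 0 < sp (k j) by exact: side_pow_gt0.
have HEP : (H (dinterior (k j) P `&` E) <= (theta * sp (k j) * K1)%:E)%E.
  have [D Dcov Dsum] := par j.
  pose F i : set V := if D i then dcube (k0 i) (m0 i) else set0.
  apply: (@le_trans _ _ (H (\bigcup_i F i))).
    apply: le_hcontent => y [yP /Ecov[i _ yi]]; exists i => //.
    by rewrite /F (Dcov _ _ yP yi).
  apply: le_trans (hcontent_bigcup _ _) _.
  rewrite (@eq_eseriesr _ _ (fun i => K1%:E * (if D i then (sp (k0 i))%:E else 0))%E); last first.
    move=> i _; rewrite /F; case: ifP => _; last by rewrite hcontent0// mule0.
    by rewrite hcontent_dcube mulrC EFinM.
  rewrite nneseriesZl; last first.
    by move=> i _; case: ifP => // _; rewrite lee_fin ltW// side_pow_gt0.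
  by rewrite mulrC EFinM lee_pmul2l ?lte_fin.
(* [x] links the centres of the unit cube and of [P]. *)
have [x [xP xE xFP]] : exists x, [/\ dinterior (k j) P x,
    ~ (dinterior (k j) P `&` E) x & ~ FP x].
  apply: (hcontent_avoid beta_gt0); apply: lt_le_trans (hcontent_dinterior _ _).
  apply: le_lt_trans (leeD HEP HFP) _; rewrite -EFinD lte_fin/=.
  have : q * sp (k j) < 2^-1 `^ beta * K1 / 2 * sp (k j) by rewrite ltr_pM2r.
  by lra.
(* [y] links the centres of [P] and of the stopping cube; the two links together use four steps of
   size [lam]. *)
have [y [yS yFP yFS]] : exists y, [/\ dcube kS (m j) y, ~ FP y & ~ FS y].
  apply: (hcontent_avoid beta_gt0); rewrite hcontent_dcube spS.
  apply: le_lt_trans (leeD HFP HFS) _; rewrite -EFinD lte_fin spS.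
  have : q * sp (k j) < 2^-1 `^ beta * K1 / 2 * sp (k j) by rewrite ltr_pM2r.
  have : q * (sp (k j) * 2^-1 `^ beta) <= q * sp (k j).
    by rewrite ler_pM2l// ler_piMr ?(ltW spP0).
  by lra.
have xPc := dinterior_sub xP.
have v1 : `|v x - c 0 1| <= lam.
  rewrite leNgt; apply/negP => h; apply: xE; split => //; split => //.
  exact: dcube_sub_unit uP _ xPc.
have v2 : `|v x - cP| <= lam by rewrite leNgt; apply/negP => h; exact: xFP.
have v3 : `|v y - cP| <= lam.
  by rewrite leNgt; apply/negP => h; apply: yFP; split => //; exact: SP.
have v4 : `|v y - cS| <= lam by rewrite leNgt; apply/negP => h; exact: yFS.
move: v1 v2 v3 v4; rewrite !ler_norml.
by move=> /andP[? ?] /andP[? ?] /andP[? ?] /andP[? ?]; apply/andP; split; lra.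
Qed.

(** Induction over all [v] and [c], so that it applies to rescalings. Above level [5 * lam * n.+1] a
    point lies in some stopping cube, and changing centre costs at most [4 * lam], so level
    [5 * lam * n] is still exceeded there; the weights sum to one half. *)
Lemma geometric_decay n v c : weak_bmo beta (@unit_cube R d) 1%:M M v c ->
  (H [set y | unit_cube y /\ (5 * lam * n%:R < `|v y - c 0 1|)%R]
    <= (K1 * 2^-1 ^+ n)%:E)%E.
Proof.
have K0 := unit_content_gt0; have lam0 := lam_gt0.
elim: n v c => [|n IH] v c vM.
  rewrite expr0 mulr1 -hcontent_unit_cube; apply: le_hcontent => y [].
  by [].
have [f [k [m [um cov sumf cdiff]]]] := calderon_zygmund vM.
have pos j : 0 < 2 ^- j :> R by rewrite invr_gt0 exprn_gt0.
pose c' j := c (corner R (k j) (m j)) (2 ^- k j).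
pose F j : set V := if f j
  then [set y | dcube (k j) (m j) y /\ 5 * lam * n%:R < `|v y - c' j|] else set0.
apply: (@le_trans _ _ (H (\bigcup_j F j))).
  apply: le_hcontent => y [Iy ylam].
  have ln0 : 0 <= lam * n%:R by rewrite mulr_ge0// ltW.
  have ylam1 : lam < `|v y - c 0 1|.
    by apply: le_lt_trans ylam; rewrite -natr1; lra.
  have [j fj yj] := cov _ Iy ylam1; exists j => //; rewrite /F fj; split => //.
  have h1 := cdiff j; have h2 := ler_distD (c' j) (v y) (c 0 1).
  rewrite -/(c' j) in h1.
  by move: ylam; rewrite -natr1; lra.
apply: le_trans (hcontent_bigcup _ _) _.
apply: (@le_trans _ _ (\sum_(0 <= j <oo)
    ((K1 * 2^-1 ^+ n)%:E * (if f j then (sp (k j))%:E else 0)))%E).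
  apply: lee_nneseries => [j _ _|j _]; first exact: hcontent_ge0.
  rewrite /F; case: ifP => _; last by rewrite hcontent0// mule0.
  have SI := @dcube_sub_unit R _ _ _ (um j).
  have := IH _ _ (weak_bmo_rescale (@orthogonal_mx1 R d) vM (pos (k j)) SI).
  rewrite /= affine0 mulr1 -/(c' j) => Hj.
  rewrite /dcube cubeE -(affine_set _ _ _ _ [set x | 5 * lam * n%:R < `|v x - c' j|]).
  rewrite hcontent_affine//; last exact: orthogonal_mx1.
  by rewrite [leRHS]muleC lee_pmul2l ?lte_fin ?side_pow_gt0.
rewrite nneseriesZl; last first.
  by move=> j _; case: ifP => // _; rewrite lee_fin ltW// side_pow_gt0.
rewrite exprSr mulrA [leRHS]EFinM lee_pmul2l//.
by rewrite lte_fin mulr_gt0// exprn_gt0// invr_gt0.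
Qed.

End Step.

Lemma exists_small_level : exists q : R, [/\ 0 < q, q < 2^-1 `^ beta * K1 / 2,
  2 * q <= w * 2^-1 `^ beta &
  (3 ^ d)%:R * (4 `^ beta / w * (2 * q)) <= theta / 2].
Proof.
have K0 := unit_content_gt0.
have h0 : 0 < 2^-1 `^ beta :> R by rewrite powR_gt0// invr_gt0.
have h4 : 0 < 4 `^ beta / w by rewrite divr_gt0// powR_gt0.
have h3 : 0 < (3 ^ d)%:R :> R by rewrite ltr0n expn_gt0.
pose X : R := (3 ^ d)%:R * (4 `^ beta / w) * 2.
have X0 : 0 < X by apply: mulr_gt0 => //; exact: mulr_gt0.
pose a := 2^-1 `^ beta * K1 / 4; pose b := w * 2^-1 `^ beta / 2.
pose e := 2^-1 `^ beta / 4 / X.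
have a0 : 0 < a by apply: divr_gt0 => //; exact: mulr_gt0.
have b0 : 0 < b by apply: divr_gt0 => //; exact: mulr_gt0.
have e0 : 0 < e by apply: divr_gt0 => //; exact: divr_gt0.
exists (Num.min a (Num.min b e)); split.
- by rewrite !lt_min a0 b0 e0.
- apply: (@le_lt_trans _ _ a); first by rewrite ge_min lexx.
  by rewrite /a; have : 0 < 2^-1 `^ beta * K1 by [rewrite mulr_gt0]; lra.
- set q := Num.min _ _; have : q <= b by rewrite !ge_min lexx orbT.
  by rewrite /b; lra.
- set q := Num.min _ _; have : q <= e by rewrite !ge_min lexx !orbT.
  rewrite /e ler_pdivlMr// /X => h; move: h.
  by set Y := 4 `^ beta / w; set Z := 2^-1 `^ beta; lra.
Qed.

End Decay.

(** * From the Choquet integral to weak-type bounds *)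

Section ChoquetBounds.
Variables (R : realType) (d : nat) (beta : R).
Local Notation V := 'rV[R]_d.
Local Notation H := (@hcontent R d beta).

(** For [t] in [[0, lam]] the level content is at least the one at [lam]; it is compared with that
    constant on the interval. *)
Lemma choquet_chebyshev (A : set V) (f : V -> R) (lam : R) : 0 < lam ->
  (lam%:E * H [set x | A x /\ (lam < f x)%R] <= choquet beta A f)%E.
Proof.
move=> lam0; set h := H _.
pose J : set R := [set` `[0, lam]].
apply: (@le_trans _ _ (\int[@lebesgue_measure R]_(t in `[0%R, +oo[) ((cst h) \_ J) t)%E).
  rewrite -integral_mkcondr.
  have -> : [set` `[0%R, +oo[] `&` J = J.
    by apply: setIidr => t; rewrite /J /= !in_itv/= => /andP[->].
  rewrite integral_cst; last exact: measurable_itv.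
  have muJ : lebesgue_measure J = lam%:E.
    by rewrite /J lebesgue_measure_itv/= lte_fin lam0 oppr0 adde0.
  by rewrite muleC -muJ.
apply: le_integral_nonneg => t _; rewrite patchE.
  by case: ifPn => _ //; exact: hcontent_ge0.
case: ifPn => [|_]; last exact: hcontent_ge0.
rewrite inE /J /= in_itv/= => /andP[_ tlam].
by apply: le_hcontent => x [Ax]; split => //; exact: le_lt_trans tlam _.
Qed.

(** The infimum over centres need not be attained, hence the strict bound by [N]. The centre is 0
    for parameters that do not give a subcube. *)
Lemma weak_bmo_of_bmo_norm (Q0 : set V) (U : 'M[R]_d) (u : V -> R) (N : R) :
  (bmo_norm beta Q0 U u < N%:E)%E -> exists c, weak_bmo beta Q0 U N u c.
Proof.
move=> uN.
pose P (p : V * R) (c : R) := 0 < p.2 -> cube U p.1 p.2 `<=` Q0 ->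
  forall lam : R, 0 < lam ->
    (lam%:E * H [set x | cube U p.1 p.2 x /\ (lam < `|u x - c|)%R]
      <= (N * p.2 `^ beta)%:E)%E.
have [c cP] : {c : V * R -> R & forall p, P p (c p)}.
  apply: (@choice _ _ P) => -[b s].
  have [s0|?] := pselect (0 < s); last by exists 0 => ?.
  have [bQ|?] := pselect (cube U b s `<=` Q0); last by exists 0 => ? ?.
  have sb0 : 0 < s `^ beta by exact: powR_gt0.
  have : (ereal_inf [set ((s `^ (- beta))%:E
      * choquet beta (cube U b s) (fun x => `|u x - c|%R))%E | c in [set: R]] < N%:E)%E.
    apply: le_lt_trans uN; apply: ereal_sup_ubound; exists (cube U b s, s) => //.
    by split => //; split => //; exists b.
  move=> /ereal_inf_lt[_ [c _ <-] cN]; exists c => _ _ lam lam0 /=.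
  apply: le_trans (choquet_chebyshev _ _ lam0) _.
  move: cN; rewrite powRN muleC lte_pdivrMr//= => /ltW.
  by rewrite -EFinM.
by exists (fun b s => c (b, s)) => b s s0 bQ lam lam0; exact: (cP (b, s)).
Qed.

(** A subcube has to exist, as the supremum of the empty set is [-oo]. *)
Lemma bmo_norm_ge0 (Q0 : set V) (U : 'M[R]_d) (u : V -> R) Q l :
  subcube Q0 U Q l -> (0 <= bmo_norm beta Q0 U u)%E.
Proof.
move=> QQ0; apply: le_trans (ereal_sup_ubound _); last first.
  by exists (Q, l); [exact: QQ0|reflexivity].
apply: le_ereal_inf_tmp => _ [c _ <-].
rewrite mule_ge0 ?lee_fin ?powR_ge0//.
by apply: integral_ge0 => t _; exact: hcontent_ge0.
Qed.

End ChoquetBounds.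

(** * Positive norm and zero norm *)

Lemma half_expr_le_expR (R : realType) (x : R) (k : nat) : x < k.+1%:R ->
  2^-1 ^+ k <= 2 * expR (- (ln 2 * x)).
Proof.
move=> xk; have ln20 : 0 < ln 2 :> R by rewrite ln_gt0// ltr1n.
have h : 2^-1 ^+ k.+1 <= expR (- (ln 2 * x)).
  have -> : 2^-1 ^+ k.+1 = expR (k.+1%:R * - ln 2) :> R.
    by rewrite expRM_natl expRN lnK// posrE.
  by rewrite ler_expR mulrN lerN2 mulrC ler_pM2r// ltW.
by move: h; rewrite exprS ler_pdivrMl.
Qed.

(** The intervals of radius [e n] about [c n] meet pairwise; the supremum of the left endpoints lies
    in all of them. *)
Lemma common_limit (R : realType) (c e : nat -> R) :
  (forall n m, `|c n - c m| <= e n + e m) ->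
  exists x, forall n, `|x - c n| <= e n.
Proof.
move=> ce; pose S := [set c n - e n | n in [set: nat]].
have ubS n : ubound S (c n + e n).
  move=> _ [m _ <-]; have := ce m n; rewrite ler_norml => /andP[_].
  by lra.
exists (sup S) => n; rewrite ler_norml; apply/andP; split.
  have : c n - e n <= sup S.
    by apply: ub_le_sup; [exists (c n + e n); exact: ubS|exists n].
  by lra.
have : sup S <= c n + e n by apply: ge_sup; [exists (c 0%N - e 0%N), 0%N|exact: ubS].
by lra.
Qed.

Section MainCases.
Variables (R : realType) (d : nat) (beta : R).
Local Notation V := 'rV[R]_d.
Local Notation H := (@hcontent R d beta).
Local Notation w := (omega beta).
Hypotheses (beta_gt0 : 0 < beta) (beta_le : beta <= d%:R) (w_gt0 : 0 < w).
Local Notation K1 := (unit_content d beta).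

(** With [lam = M / q], the number of iterations below level [t] is the integer part of
    [t / (5 * lam)]; rounding down costs the factor 2. *)
Lemma exponential_decay : exists2 q : R, 0 < q &
  forall (v : V -> R) (c : V -> R -> R) (M t : R), 0 < M ->
    weak_bmo beta unit_cube 1%:M M v c -> 0 < t ->
    (H [set y | unit_cube y /\ (t < `|v y - c 0 1|)%R]
      <= (2 * K1 * expR (- (q * (t / M))))%:E)%E.
Proof.
have [q [q0 q1 q2 q3]] := exists_small_level beta_gt0 beta_le w_gt0.
exists (ln 2 * (q / 5)).
  by rewrite mulr_gt0 ?divr_gt0// ln_gt0// ltr1n.
move=> v c M t M0 vM t0; pose lam := M / q.
have lam0 : 0 < lam by exact: divr_gt0.
have Ml : M <= q * lam by rewrite /lam mulrC divfK ?gt_eqF.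
have tau0 : 0 < 5 * lam by exact: mulr_gt0.
have [k0 k1] := andP (truncn_itv (ltW (divr_gt0 t0 tau0))).
set k := Num.trunc _ in k0 k1.
apply: (@le_trans _ _ (K1 * 2^-1 ^+ k)%:E).
  apply: le_trans (geometric_decay beta_gt0 beta_le w_gt0 q0 q1 q2 q3 lam0 Ml k vM).
  apply: le_hcontent => y [Iy ty]; split => //; apply: le_lt_trans ty.
  by move: k0; rewrite ler_pdivlMr// mulrC.
have K0 := unit_content_gt0 beta_gt0 beta_le w_gt0.
rewrite lee_fin -mulrA mulrCA ler_pM2l//.
have -> : ln 2 * (q / 5) * (t / M) = ln 2 * (t / (5 * lam)).
  by rewrite /lam; field; rewrite !gt_eqF.
exact: half_expr_le_expR.
Qed.

(** Each [N n] gives a centre [c n]. Two exceptional sets, each at most a third of the cube in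
    content, cannot fill it, so the centres are mutually close and one constant serves for all
    levels. *)
Lemma zero_bmo_norm (Q0 : set V) (U : 'M[R]_d) (u : V -> R) (a : V) (l : R) :
  orthogonal_mx U -> 0 < l -> cube U a l `<=` Q0 -> bmo_norm beta Q0 U u = 0%E ->
  exists c : R, forall t : R, 0 < t ->
    H [set x | cube U a l x /\ (t < `|u x - c|)%R] = 0%E.
Proof.
move=> oU l0 aQ u0; have K0 := unit_content_gt0 beta_gt0 beta_le w_gt0.
have lb0 : 0 < l `^ beta by exact: powR_gt0.
pose e (n : nat) : R := n.+1%:R^-1.
have e0 n : 0 < e n by rewrite invr_gt0 ltr0n.
have e1 n : e n <= 1 by rewrite invf_le1 ?ltr0n// ler1n.
pose N n := e n * e n * (K1 / 3).
have N0 n : 0 < N n by apply: mulr_gt0; [exact: mulr_gt0|exact: divr_gt0].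
pose P n (c : R) := forall lam : R, 0 < lam ->
  (lam%:E * H [set x | cube U a l x /\ (lam < `|u x - c|)%R]
    <= (N n * l `^ beta)%:E)%E.
have [c cP] : {c : nat -> R & forall n, P n (c n)}.
  apply: (@choice _ _ P) => n.
  have [|c cN] := @weak_bmo_of_bmo_norm _ _ beta Q0 U u (N n).
    by rewrite u0 lte_fin.
  by exists (c a l) => lam lam0; exact: cN.
pose B n : set V := [set x | cube U a l x /\ e n < `|u x - c n|].
have HB n : (H (B n) <= (K1 / 3 * l `^ beta)%:E)%E.
  rewrite -(@lee_pmul2l _ (e n)%:E) ?lte_fin//; apply: le_trans (cP n _ (e0 n)) _.
  rewrite -EFinM lee_fin mulrA ler_wpM2r ?powR_ge0//.
  rewrite /N ler_wpM2r ?divr_ge0 ?(ltW K0)//.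
  by rewrite ler_piMr ?(ltW (e0 n)).
have cc n m : `|c n - c m| <= e n + e m.
  have [x [xQ xn xm]] : exists x, [/\ cube U a l x, ~ B n x & ~ B m x].
    apply: (hcontent_avoid beta_gt0).
    rewrite hcontent_cube// hcontent_unit_cube//.
    apply: le_lt_trans (leeD (HB n) (HB m)) _; rewrite -EFinD lte_fin.
    have : 0 < K1 * l `^ beta by exact: mulr_gt0.
    by lra.
  have h1 : `|u x - c n| <= e n by rewrite leNgt; apply/negP => h; exact: xn.
  have h2 : `|u x - c m| <= e m by rewrite leNgt; apply/negP => h; exact: xm.
  move: h1 h2; rewrite !ler_norml => /andP[? ?] /andP[? ?].
  by apply/andP; split; lra.
have [x xc] := common_limit cc; exists x => t t0.
apply/eqP; rewrite eq_le hcontent_ge0 andbT; apply/lee_addgt0Pr => r r0.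
rewrite add0e.
pose X := K1 / 3 * l `^ beta.
have X0 : 0 < X by apply: mulr_gt0 => //; exact: divr_gt0.
(* The first bound keeps [c n] within [t / 2] of [x]; the second makes the remaining content at most
   [r]. *)
pose y := Num.min (t / 2) (r * (t / 2) / X).
have t20 : 0 < t / 2 by exact: divr_gt0.
have y0 : 0 < y.
  by rewrite lt_min t20/=; apply: divr_gt0 => //; exact: mulr_gt0.
pose n := Num.trunc y^-1.
have en : e n < y by rewrite /e invf_plt ?posrE ?ltr0n// truncnS_gt.
have yt : y <= t / 2 by rewrite ge_min lexx.
have yr : y <= r * (t / 2) / X by rewrite ge_min lexx orbT.
rewrite -(@lee_pmul2l _ (t / 2)%:E) ?lte_fin//.
apply: (@le_trans _ _ ((t / 2)%:E * H [set z | cube U a l z /\ (t / 2 < `|u z - c n|)%R])%E).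
  rewrite lee_pmul2l ?lte_fin//; apply: le_hcontent => z [zQ tz]; split => //.
  have := xc n; have := ler_distD (c n) (u z) x; rewrite (distrC (c n)).
  by move: tz en yt; lra.
apply: le_trans (cP n _ t20) _; rewrite -EFinM lee_fin.
have -> : N n * l `^ beta = e n * e n * X by rewrite /N /X -mulrA.
apply: (@le_trans _ _ (e n * X)).
  by rewrite ler_wpM2r ?(ltW X0)// ler_piMr ?(ltW (e0 n)).
rewrite (mulrC (t / 2)) -ler_pdivlMr//.
by apply: le_trans yr; exact: ltW.
Qed.

End MainCases.

(* exp(-c t / ||u||) is taken in \bar R, so that ||u|| = 0 gives
   -(c t) * +oo = -oo and expeR (-oo) = 0 (the usual convention). *)
Theorem theorem1p3 (R : realType) (d : nat) (beta : R)
    (Q0 : set 'rV[R]_d) (U : 'M[R]_d) (l0 : R) :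
  0 < beta -> beta <= d%:R -> is_cube Q0 U l0 ->
  exists c C : R, 0 < c /\ 0 < C /\
    forall (u : 'rV[R]_d -> R), BMO beta Q0 U u ->
    forall (Q : set 'rV[R]_d) (l : R), subcube Q0 U Q l ->
    exists cQ : R, forall t : R, 0 < t ->
      (hcontent beta [set x | Q x /\ (t < `|u x - cQ|)%R]
       <= (C * powR l beta)%:E
          * expeR (- (c * t)%:E / bmo_norm beta Q0 U u))%E.
Proof.
move=> b0 bd [oU _].
have [w0|w0] := ltP 0 (omega beta : R); last first.
  exists 1, 1; split => //; split => // u _ Q l _; exists 0 => t _.
  by rewrite hcontent_omega_le0// mule_ge0 ?expeR_ge0// lee_fin mul1r powR_ge0.
have [q q0 decay] := exponential_decay b0 bd w0.
have K0 := unit_content_gt0 b0 bd w0.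
exists (q / 2), (2 * unit_content d beta).
split; first exact: divr_gt0.
split; first exact: mulr_gt0.
move=> u [_ ufin] Q l QQ0; have [l0' [[a QE] aQ]] := QQ0.
have lb0 : 0 < l `^ beta by exact: powR_gt0.
have n0 := bmo_norm_ge0 beta u QQ0.
rewrite {}QE in aQ *.
have [n nE] : exists n, bmo_norm beta Q0 U u = n%:E.
  by exists (fine (bmo_norm beta Q0 U u)); rewrite fineK// ge0_fin_numE.
rewrite nE lee_fin in n0; rewrite nE.
have [nz|nN0] := eqVneq n 0.
  have [|cQ cQ0] := @zero_bmo_norm _ _ beta b0 bd w0 Q0 U u a l oU l0' aQ.
    by rewrite nE nz.
  exists cQ => t t0; rewrite cQ0// mule_ge0 ?expeR_ge0// lee_fin.
  by rewrite !mulr_ge0 ?powR_ge0// ltW.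
have {nN0}n0 : 0 < n by rewrite lt_def nN0.
(* Doubling a positive norm gives the strict bound, hence the rate [q / 2]. *)
have [|c cM] := @weak_bmo_of_bmo_norm _ _ beta Q0 U u (2 * n).
  by rewrite nE lte_fin ltr_pMl// ltr1n.
exists (c a l) => t t0.
have := decay _ _ _ t (mulr_gt0 (ltr0n _ 2) n0) (weak_bmo_rescale oU cM l0' aQ) t0.
rewrite /= affine0 mulr1 => ut.
rewrite cubeE -(affine_set _ _ _ _ [set x | t < `|u x - c a l|]).
rewrite hcontent_affine// inver gt_eqF// -[X in expeR X]EFinM.
rewrite [expeR _]/= (mulrC _ (l `^ beta)) [in leRHS]EFinM -muleA lee_pmul2l ?lte_fin//.
apply: le_trans ut _; rewrite -EFinM lee_fin.
suff -> : - (q * (t / (2 * n))) = - (q / 2 * t) / n by [].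
by field; rewrite gt_eqF.
Qed.
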